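(* Let $j>1$ be real. Then: (a) $\int_0^\infty\eta^{j-1}(ix)\,dx\ \geq\ \int_0^\infty\eta^j(ix)\,dx$; (b) $\int_0^\infty\eta^j(ix)\,dx\ \leq\ \dfrac{12}{\pi j}$; (c) more generally than (a), for every real $n\ge0$, $\int_0^\infty x^n\eta^{j-1}(ix)\,dx\ \geq\ \int_0^\infty x^n\eta^j(ix)\,dx$.
   Context: Here $\eta$ is the Dedekind eta function; for $x>0$, $\eta(ix)=q^{1/24}\prod_{n\ge1}(1-q^n)$ with $q=e^{-2\pi x}$, which is a positive real number, and $\eta^s(ix)$ means $(\eta(ix))^s$. *)

(* Defs.v *)
From HB Require Import structures.
From mathcomp Require Import all_boot all_order all_algebra.
From mathcomp Require Import all_classical all_reals all_analysis.
Set Implicit Arguments.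
Unset Strict Implicit.
Unset Printing Implicit Defensive.
Import Order.TTheory GRing.Theory Num.Theory.
Import numFieldNormedType.Exports.
Local Open Scope classical_set_scope.
Local Open Scope ring_scope.

Definition nome (R : realType) (x : R) : R := expR (- (2 * pi * x)).

(* The Dedekind eta function on the positive imaginary axis: for 0 < x this is
   the real number eta(ix).  The partial products are nonincreasing and
   nonnegative there, so the limit exists. *)
Definition eta_im (R : realType) (x : R) : R :=
  nome x `^ (24%:R^-1) *
  limn (fun N : nat => \prod_(1 <= n < N.+1) (1 - nome x ^+ n)).

(* Main.v *)
Require Import Defs.
From HB Require Import structures.
From mathcomp Require Import all_boot all_order all_algebra.
From mathcomp Require Import all_classical all_reals all_analysis.
From mathcomp Require Import measurable_realfun ring.
Import Order.TTheory GRing.Theory Num.Theory.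
Import numFieldNormedType.Exports.
Local Open Scope classical_set_scope.
Local Open Scope ring_scope.
Local Open Scope ereal_scope.

(** The Euler product lies in [[0, 1]], so that
    [0 <= eta(ix) <= q^{1/24} = exp (- pi x / 12) <= 1].  Hence
    [eta^j <= eta^(j-1)] pointwise, and the integral of [eta^j] is at most that
    of [exp (- pi j x / 12)], which is [12 / (pi j)]. *)

(* Unlike [ge0_le_integral], no measurability is assumed: the integral of a
   nonnegative function is the supremum over the simple functions below it. *)
Lemma ge0_le_integral_nomeas {d : measure_display} {T : measurableType d}
    {R : realType} (mu : {measure set T -> \bar R}) (D : set T)
    (f g : T -> \bar R) :
  (forall x, D x -> 0 <= f x) -> (forall x, D x -> f x <= g x) ->
  \int[mu]_(x in D) f x <= \int[mu]_(x in D) g x.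
Proof.
move=> f0 fg.
have g0 x : D x -> 0 <= g x by move=> Dx; exact: le_trans (f0 _ Dx) (fg _ Dx).
rewrite !ge0_integralE//; apply: ereal_sup_le => _ [h hf <-].
exists h => // x; apply: le_trans (hf x) _.
by rewrite !patchE; case: ifPn => // /set_mem; exact: fg.
Qed.

Local Close Scope ereal_scope.

Section eta_bounds.
Context {R : realType}.
Implicit Types x j : R.

Lemma nome_le1 x : 0 <= x -> 0 <= nome x <= 1.
Proof.
move=> x0; rewrite expR_ge0 -expR0 ler_expR oppr_le0.
by rewrite !mulr_ge0// pi_ge0.
Qed.

(** Every factor lies in [0, 1], so the partial products are nonnegative and nonincreasing; hence
    they converge and the bounds pass to the limit. *)
Lemma limn_euler_product_itv (q : R) : 0 <= q <= 1 ->
  0 <= limn (fun N : nat => \prod_(1 <= n < N.+1) (1 - q ^+ n)) <= 1.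
Proof.
move=> q01; set u := fun N : nat => _.
have fac n : 0 <= 1 - q ^+ n <= 1.
  case/andP: q01 => q0 q1.
  by rewrite subr_ge0 exprn_ile1//= gerBl exprn_ge0.
have u0 n : 0 <= u n by apply: prodr_ge0 => i _; case/andP: (fac i).
have u_decr : nonincreasing_seq u.
  apply/nonincreasing_seqP => n; rewrite /u big_nat_recr//=.
  by rewrite ler_piMr//; [exact: u0 | case/andP: (fac n.+1)].
have u_cvg : cvgn u.
  by apply: nonincreasing_is_cvgn => //; exists 0 => _ [n _ <-].
apply/andP; split.
  by apply: limr_ge => //; exact: nearW.
apply: limr_le => //; apply: nearW => n.
(* [u 0] is the empty product 1, which dominates all later terms. *)
by apply: le_trans (u_decr 0%N n _) _ => //; rewrite /u big_nil.
Qed.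

Lemma eta_im_ge0 x : 0 <= x -> 0 <= eta_im x.
Proof.
move=> x0; rewrite mulr_ge0 ?powR_ge0//.
by have /limn_euler_product_itv/andP[] := nome_le1 x x0.
Qed.

Lemma eta_im_le_expR x : 0 <= x -> eta_im x <= expR (- (pi / 12%:R * x)).
Proof.
move=> x0.
have -> : expR (- (pi / 12%:R * x)) = nome x `^ (24%:R^-1).
  by rewrite /nome -expRM; congr expR; field.
rewrite ler_piMr ?powR_ge0//.
by have /limn_euler_product_itv/andP[] := nome_le1 x x0.
Qed.

Lemma eta_im_le1 x : 0 <= x -> eta_im x <= 1.
Proof.
move=> x0; apply: le_trans (eta_im_le_expR x x0) _.
by rewrite -expR0 ler_expR oppr_le0 mulr_ge0// divr_ge0// pi_ge0.
Qed.

Lemma eta_im_powR_homo x j : 0 <= x -> 1 < j ->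
  eta_im x `^ j <= eta_im x `^ (j - 1).
Proof.
move=> x0 j1.
(* Only [0 <= eta_im x] has been shown, so the value 0 is treated apart: there the left side is 0
   because [j] is nonzero. For a base in (0, 1], a larger exponent gives a smaller power. *)
have := eta_im_ge0 x x0; rewrite le_eqVlt => /predU1P[<-|eta0].
  by rewrite powR0 ?powR_ge0// gt_eqF// (lt_trans _ j1).
by rewrite ger_powR ?eta0 ?eta_im_le1// gerBl.
Qed.

Lemma eta_im_powR_le x j : 0 <= x -> 0 <= j ->
  eta_im x `^ j <= expR (- (pi * j / 12%:R * x)).
Proof.
move=> x0 j0.
have -> : expR (- (pi * j / 12%:R * x)) = expR (- (pi / 12%:R * x)) `^ j.
  by rewrite -expRM; congr expR; field.
by rewrite ge0_ler_powR// ?nnegrE ?eta_im_ge0 ?expR_ge0// eta_im_le_expR.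
Qed.

(** On the half-line the integrand is [r^-1] times the exponential density of rate [r], whose total
    mass is 1. *)
Lemma integral_expR_le (r : R) : 0 < r ->
  (\int[lebesgue_measure]_(x in `]0%R, +oo[) (expR (- (r * x)))%:E
    <= (r^-1)%:E)%E.
Proof.
move=> r0.
have rpdf0 x : 0 <= r^-1 * exponential_pdf r x.
  by rewrite mulr_ge0 ?invr_ge0 ?exponential_pdf_ge0// ltW.
have -> : (r^-1)%:E =
    (\int[lebesgue_measure]_x (r^-1 * exponential_pdf r x)%:E)%E.
  under eq_integral do rewrite EFinM.
  rewrite ge0_integralZl ?integral_exponential_pdf ?mule1//.
  - by apply/measurable_EFinP; exact: measurable_exponential_pdf.
  - by move=> x _; rewrite lee_fin exponential_pdf_ge0// ltW.
  - by rewrite lee_fin invr_ge0 ltW.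
(* Extended by 0 to the whole line, the integrand equals the scaled density for positive [x] and is
   at most it elsewhere. *)
rewrite integral_mkcond; apply: ge0_le_integral_nomeas => x _.
  by apply: erestrict_ge0 => y _; rewrite lee_fin expR_ge0.
rewrite patchE; case: ifPn => [/set_mem/= | _]; last by rewrite lee_fin.
rewrite in_itv/= andbT => x0.
by rewrite lee_fin exponential_pdfE ?(ltW x0)// mulNr mulKf// gt_eqF.
Qed.

End eta_bounds.

Local Open Scope ereal_scope.

Theorem proposition4 (R : realType) (j : R) (hj : (1 < j)%R) :
  [/\ \int[lebesgue_measure]_(x in `]0%R, +oo[) (eta_im x `^ (j - 1))%R%:E >=
        \int[lebesgue_measure]_(x in `]0%R, +oo[) (eta_im x `^ j)%R%:E,
      \int[lebesgue_measure]_(x in `]0%R, +oo[) (eta_im x `^ j)%R%:E <=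
        (12%:R / (pi * j))%R%:E
    & forall n : R, (0 <= n)%R ->
      \int[lebesgue_measure]_(x in `]0%R, +oo[)
          (x `^ n * eta_im x `^ (j - 1))%R%:E >=
        \int[lebesgue_measure]_(x in `]0%R, +oo[)
          (x `^ n * eta_im x `^ j)%R%:E ].
Proof.
have j0 : (0 < j)%R by exact: lt_trans hj.
have pos x : `]0%R, +oo[%classic x -> (0 <= x :> R)%R.
  by rewrite /= in_itv/= andbT => /ltW.
split=> [||n _].
- apply: ge0_le_integral_nomeas => x /pos x0; rewrite lee_fin ?powR_ge0//.
  exact: eta_im_powR_homo.
- have r0 : (0 < pi * j / 12%:R :> R)%R by rewrite divr_gt0// mulr_gt0// pi_gt0.
  (* The bound is the inverse of the decay rate [pi * j / 12]. *)
  rewrite -[X in X%:E]invf_div; apply: le_trans (integral_expR_le _ r0).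
  apply: ge0_le_integral_nomeas => x /pos x0; rewrite lee_fin ?powR_ge0//.
  by rewrite eta_im_powR_le// ltW.
(* The nonnegative weight preserves the pointwise comparison of the two powers. *)
- apply: ge0_le_integral_nomeas => x /pos x0; rewrite lee_fin.
    by rewrite mulr_ge0 ?powR_ge0.
  by rewrite ler_wpM2l ?powR_ge0// eta_im_powR_homo.
Qed.
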